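(* Let $G_1=(V_1,E_1)$ and $G_2=(V_2,E_2)$ be finite simple graphs with disjoint vertex sets and with $|V_i|=n_i\geq 1$ for $i=1,2$, and set $$B=\left\lceil\frac{n_1n_2}{n_1+n_2-1}\right\rceil-1.$$ Then $$\max\{\operatorname{arb}(G_1),\operatorname{arb}(G_2),B\}\leq\operatorname{arb}(G_1* G_2)\leq\operatorname{arb}(G_1)+\operatorname{arb}(G_2)+B+1,$$ where $G_1*G_2$ is the join of $G_1$ and $G_2$ and $\operatorname{arb}$ denotes the reduced arboricity.
   Context: All graphs are finite and simple. A forest is a graph containing no cycles. Reduced arboricity: for a graph $G$ with $E(G)\neq\varnothing$, let $k$ be the minimum number of forests whose edge sets partition $E(G)$, and set $\operatorname{arb}(G)=k-1$ (so it is one less than the classical arboricity). If $E(G)=\varnothing$, set $\operatorname{arb}(G)=0$. Join: for graphs $G_1=(V_1,E_1)$ and $G_2=(V_2,E_2)$ with disjoint vertex sets, the join $G_1*G_2$ is the graph with vertex set $V_1\cup V_2$ and edge set $E_1\cup E_2\cup\{uv: u\in V_1,\ v\in V_2\}$. *)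

(* Defs.v *)
From mathcomp Require Import all_boot.
Set Implicit Arguments.
Unset Strict Implicit.
Unset Printing Implicit Defensive.

Record sgraph (V : finType) := SGraph {
  adj :> rel V;
  adj_sym : symmetric adj;
  adj_irr : irreflexive adj
}.

Definition edges (V : finType) (G : sgraph V) : {set {set V}} :=
  [set [set p.1; p.2] | p : V * V & G p.1 p.2].

Definition edge_rel (V : finType) (F : {set {set V}}) : rel V :=
  fun x y => (x != y) && ([set x; y] \in F).

Lemma edge_rel_sym (V : finType) (F : {set {set V}}) : symmetric (edge_rel F).
Proof. by move=> x y; rewrite /edge_rel eq_sym setUC. Qed.

Lemma edge_rel_irr (V : finType) (F : {set {set V}}) :
  irreflexive (edge_rel F).
Proof. by move=> x; rewrite /edge_rel eqxx. Qed.

Definition edge_graph (V : finType) (F : {set {set V}}) : sgraph V :=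
  SGraph (edge_rel_sym F) (edge_rel_irr F).

(* A cycle is a closed walk through at least 3 pairwise distinct vertices, so
   its length is at most #|V|; bounding it makes the predicate boolean. *)
Definition is_forest (V : finType) (G : sgraph V) : bool :=
  [forall k : 'I_#|V|.+1, forall t : k.-tuple V,
     (2 < k) ==> ~~ ucycleb G t].

Lemma is_forestP (V : finType) (G : sgraph V) :
  reflect (forall s : seq V, 2 < size s -> ~ ucycle G s) (is_forest G).
Proof.
apply: (iffP idP) => [/forallP GF s s2 sC | GF].
  have sV : size s < #|V|.+1.
    by have /andP[_ /card_uniqP <-] := sC; rewrite ltnS max_card.
  have /forallP/(_ (in_tuple s))/implyP/(_ s2)/negP := GF (Ordinal sV).
  exact.
apply/forallP => k; apply/forallP => t; apply/implyP => k2.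
by apply/negP; apply: GF; rewrite size_tuple.
Qed.

(* The forests are given by their edge sets, as spanning subgraphs of V. The
   blocks of a partition are nonempty, which does not affect the minimum. *)
Definition forest_partition (V : finType) (G : sgraph V)
    (P : {set {set {set V}}}) : bool :=
  partition P (edges G) && [forall F in P, is_forest (edge_graph F)].

Definition forest_decomposable (V : finType) (G : sgraph V) (k : nat) : bool :=
  [exists P, forest_partition G P && (#|P| == k)].

Lemma ex_forest_decomposable (V : finType) (G : sgraph V) :
  exists k, forest_decomposable G k.
Proof.
pose P := [set [set e] | e in edges G].
exists #|P|; apply/existsP; exists P; rewrite eqxx andbT.
apply/andP; split.
  apply/and3P; split.
  - apply/eqP/setP => e; apply/bigcupP/idP => [[F /imsetP[f fE ->]]|eE].
      by rewrite inE => /eqP ->.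
    by exists [set e]; rewrite ?set11 ?imset_f.
  - apply/trivIsetP => _ _ /imsetP[e _ ->] /imsetP[f _ ->] ef.
    by rewrite disjoints1 inE; apply: contraNneq ef => ->.
  - by apply/imsetP => -[e _] /setP/(_ e); rewrite !inE eqxx.
apply/forall_inP => _ /imsetP[e _ ->]; apply/is_forestP.
case=> [|x [|y [|z s]]] // _ /andP[].
rewrite /= /edge_rel !inE => /and3P[/andP[xy /eqP exy] /andP[yz /eqP eyz] _].
move=> /andP[/norP[_ /norP[xz _]] _].
have := set21 x y; rewrite exy -eyz !inE.
by rewrite (negPf xy) (negPf xz).
Qed.

(* The reduced arboricity: one less than the classical one if G has an edge. *)
Definition arb (V : finType) (G : sgraph V) : nat :=
  if edges G == set0 then 0 else (ex_minn (ex_forest_decomposable G)).-1.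

(* Disjointness of the two vertex sets is built into the sum type. *)
Definition join_rel (V1 V2 : finType) (G1 : sgraph V1) (G2 : sgraph V2) :
    rel (V1 + V2)%type :=
  fun u v => match u, v with
             | inl x, inl y => G1 x y
             | inr x, inr y => G2 x y
             | _, _ => true
             end.

Lemma join_rel_sym (V1 V2 : finType) (G1 : sgraph V1) (G2 : sgraph V2) :
  symmetric (join_rel G1 G2).
Proof. by case=> x [] y //=; apply: adj_sym. Qed.

Lemma join_rel_irr (V1 V2 : finType) (G1 : sgraph V1) (G2 : sgraph V2) :
  irreflexive (join_rel G1 G2).
Proof. by case=> x /=; apply: adj_irr. Qed.

Definition join (V1 V2 : finType) (G1 : sgraph V1) (G2 : sgraph V2) :
    sgraph (V1 + V2)%type :=
  SGraph (join_rel_sym G1 G2) (join_rel_irr G1 G2).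

(* Main.v *)
(* arb G <= k means that the edges of G can be coloured with k + 1 colours, all
   colour classes being forests. A colouring of the join restricts to G1 and
   G2, and each of its classes has at most n1 + n2 - 1 edges, which gives the
   lower bound. For the upper bound, G1 and G2 share arb G1 + arb G2 + 1 colours
   because they are disjoint, and it remains to split K_{m,n} into c forests
   whenever m n <= c (m + n - 1).

   Let m <= n. If m <= c, use stars. Otherwise m = a + c with a < c and
   n a <= c (m - 1). Each of the n columns is a colouring of Z_m in which a
   colours occur twice, on edges (x, x + 1) of the cycle Z_m, and c - a colours
   occur once. The n a double occurrences are listed column by column: the s-th
   one has colour s mod c and sits at x = walk s, where walk advances by about 2
   so that the edges in one column are disjoint, while the at most m - 1 edges
   of a given colour are distinct. Each colour class is then a caterpillar along
   a Hamiltonian path of the cycle. *)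

Require Import Defs.
From HB Require Import structures.
From mathcomp Require Import all_boot all_order all_algebra.
From mathcomp Require Import zify.
Set Implicit Arguments.
Unset Strict Implicit.
Unset Printing Implicit Defensive.
Import Order.TTheory GRing.Theory Num.Theory.

(** * Acyclic relations and vertex orderings *)

Definition acyclic (V : eqType) (e : rel V) : Prop :=
  forall s : seq V, 2 < size s -> ~ ucycle e s.

Lemma acyclic_inj (V W : eqType) (f : V -> W) (e : rel V) (e' : rel W) :
  injective f -> (forall x y, e x y -> e' (f x) (f y)) ->
  acyclic e' -> acyclic e.
Proof.
move=> f_inj ee' e'A s s2 /andP[eC sU]; apply: (e'A (map f s)).
  by rewrite size_map.
rewrite /ucycle map_inj_uniq // sU andbT.
case: s eC {s2 sU} => //= x s; rewrite -map_rcons path_map.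
exact: sub_path.
Qed.

Lemma acyclic_sub (V : eqType) (e e' : rel V) :
  subrel e e' -> acyclic e' -> acyclic e.
Proof. by apply: (@acyclic_inj _ _ id). Qed.

(* The two cycle neighbours of a lowest vertex of a cycle are not below it. *)
Lemma acyclic_of_ord (V : finType) (e : rel V) (ord : V -> nat) :
  symmetric e ->
  (forall v w1 w2, e v w1 -> e v w2 ->
     ord v <= ord w1 -> ord v <= ord w2 -> w1 = w2) ->
  acyclic e.
Proof.
move=> eS eO [//|x0 s] s2 sC.
have x0s : x0 \in x0 :: s by rewrite mem_head.
case: (arg_minnP ord x0s) => x xs xmin.
have [i s' Es] := rot_to xs.
move: s2 sC; rewrite -(rot_ucycle i) -(size_rot i) Es.
have {}xmin y : y \in x :: s' -> ord x <= ord y.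
  by rewrite -Es mem_rot => /xmin.
case: s' xmin {Es} => [|y [|z s']] // xmin _ /andP[].
rewrite /= rcons_path => /and3P[exy _ /andP[_ ezx]] /and3P[_ yN _].
have zs : last z s' \in z :: s' by apply: mem_last.
move: yN; rewrite (eO x y (last z s')) ?zs //; first by rewrite eS.
  by apply: xmin; rewrite !inE eqxx orbT.
by apply: xmin; rewrite inE (in_cons y) zs !orbT.
Qed.

(** If every vertex of [S] had two neighbours in [S], a path could always be extended without
    turning back. A repeated vertex would close a cycle, so the paths would be arbitrarily long,
    against the finiteness of [V]. *)
Lemma acyclic_leaf (V : finType) (e : rel V) (S : {set V}) :
  symmetric e -> irreflexive e -> acyclic e -> S != set0 ->
  exists2 x, x \in S &
    {in S &, forall w1 w2, e x w1 -> e x w2 -> w1 = w2}.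
Proof.
move=> eS eI eA /set0Pn[x0 x0S].
have [/exists_inP[x xS /forall_inP xL]|noL] := boolP [exists x in S,
    forall w1 in S, forall w2 in S, e x w1 ==> e x w2 ==> (w1 == w2)].
  exists x => // w1 w2 w1S w2S e1 e2; apply/eqP.
  by move/forall_inP: (xL _ w1S) => /(_ _ w2S); rewrite e1 e2.
have nbr x z : x \in S -> exists y, [/\ y \in S, e x y & y != z].
  move=> xS; move/exists_inPn: noL => /(_ x xS).
  rewrite negb_forall_in => /exists_inP[w1 w1S].
  rewrite negb_forall_in => /exists_inP[w2 w2S].
  rewrite !negb_imply => /and3P[e1 e2 w12].
  have [E|] := eqVneq w1 z; last by exists w1.
  by exists w2; rewrite -E eq_sym.
have long k : exists x p,
    [/\ size p = k, path e x p, uniq (x :: p) & x \in S].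
  elim: k => [|k [x [p [<- xp pU xS]]]]; first by exists x0, [::].
  have [y [yS exy yN]] := nbr x (head x p) xS.
  exists y, (x :: p); split=> //=; first by rewrite eS exy.
  move: (pU) => /= ->; rewrite andbT inE negb_or.
  have -> /= : y != x by apply: contraTneq exy => ->; rewrite eI.
  apply/negP => /splitPr yp; case: yp xp pU yN => p1 p2.
  rewrite -cat_rcons cat_path -cat_cons cat_uniq => /andP[xp _] /andP[pU _] yN.
  apply: (eA (x :: rcons p1 y)).
    by case: p1 yN {xp pU} => [|z p1] /=; rewrite ?eqxx // size_rcons.
  by rewrite /ucycle pU andbT /= rcons_path xp last_rcons eS.
have [x [p [sp _ /card_uniqP pU _]]] := long #|V|.
by have := max_card (mem (x :: p)); rewrite pU /= sp ltnn.
Qed.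

(** Converse of [acyclic_of_ord]: leaves are stripped one at a time, each ranked below everything
    that remains. *)
Lemma acyclic_ord (V : finType) (e : rel V) :
  symmetric e -> irreflexive e -> acyclic e ->
  exists2 ord : V -> nat, injective ord &
    forall v w1 w2, e v w1 -> e v w2 ->
      ord v <= ord w1 -> ord v <= ord w2 -> w1 = w2.
Proof.
move=> eS eI eA.
suff IH n (S : {set V}) : #|S| = n -> exists2 ord : V -> nat,
    {in S &, injective ord} &
    {in S & &, forall v w1 w2, e v w1 -> e v w2 ->
      ord v <= ord w1 -> ord v <= ord w2 -> w1 = w2}.
  have [ord oI oP] := IH _ setT erefl.
  exists ord => [x y|v w1 w2]; first by apply: oI; rewrite inE.
  by apply: oP; rewrite inE.
elim: n S => [|n IHn] S Sn.
  move/eqP: Sn; rewrite cards_eq0 => /eqP->.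
  by exists (fun=> 0) => x; rewrite inE.
have [|x xS xL] := acyclic_leaf eS eI eA (S := S).
  by rewrite -card_gt0 Sn.
have [|ord oI oP] := IHn (S :\ x).
  by move: Sn; rewrite (cardsD1 x) xS => -[].
exists (fun v => if v == x then 0 else (ord v).+1).
  move=> u v uS vS; case: eqVneq => [->|ux]; case: eqVneq => [->|vx] // -[].
  by apply: oI; rewrite !inE ?ux ?vx.
move=> v w1 w2 vS w1S w2S.
case: eqVneq => [->|vx]; first by move=> e1 e2 _ _; apply: xL.
case: eqVneq => // w1x; case: eqVneq => // w2x; rewrite !ltnS.
by apply: oP; rewrite !inE ?vx ?w1x ?w2x.
Qed.

(** Sending each edge to its lower endpoint in the order of [acyclic_ord] is injective and misses
    the top vertex. [E] holds each edge in at most one orientation, so edges are not counted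
    twice. *)
Lemma acyclic_card (V : finType) (e : rel V) (E : {set V * V}) :
  symmetric e -> irreflexive e -> acyclic e -> 0 < #|V| ->
  (forall p, p \in E -> e p.1 p.2 /\ (p.2, p.1) \notin E) -> #|E| < #|V|.
Proof.
move=> eS eI eA /card_gt0P[x0 _] EP.
have [ord oI oP] := acyclic_ord eS eI eA.
have [top _ topP] := @arg_maxnP V x0 predT ord isT.
pose low (p : V * V) := if ord p.1 < ord p.2 then p.1 else p.2.
pose high (p : V * V) := if ord p.1 < ord p.2 then p.2 else p.1.
have lowP p : p \in E -> e (low p) (high p) /\ ord (low p) < ord (high p).
  move=> pE; have [ep _] := EP p pE.
  rewrite /low /high; case: ltnP => // pp; rewrite eS; split=> //.
  rewrite ltn_neqAle pp andbT; apply: contraTneq ep => /oI ->.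
  by rewrite eI.
have pairE p : p = (low p, high p) \/ p = (high p, low p).
  by case: p => a b; rewrite /low /high /=; case: ifP; [left|right].
have low_inj : {in E &, injective low}.
  move=> p q pE qE pq.
  have [ep op] := lowP p pE; have [eq oq] := lowP q qE.
  have hpq : high p = high q.
    by apply: (oP (low p)) => //; rewrite ?pq // ltnW // -pq.
  have [_] := EP q qE; have [Ep|Ep] := pairE p; have [Eq|Eq] := pairE q.
  - by rewrite Ep Eq pq hpq.
  - by rewrite Eq /= -pq -hpq -Ep pE.
  - by rewrite Eq /= -pq -hpq -Ep pE.
  - by rewrite Ep Eq pq hpq.
rewrite -(card_in_imset low_inj) -cardsT; apply: proper_card.
apply/properP; split; first exact: subsetT.
exists top; first by rewrite inE.
apply/imsetP => -[p pE Etop]; have [_] := lowP p pE.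
by rewrite -Etop ltnNge; have /= -> := topP (high p) isT.
Qed.

(** * Arboricity in terms of forest colourings *)

Definition color_class (V : finType) (G : sgraph V) (col : V -> V -> nat)
    (i : nat) : rel V :=
  fun x y => G x y && (col x y == i).

(** Unlike the blocks of a partition, colour classes may be empty, which makes the notion monotone
    in [k]. Colours of non-adjacent pairs are unconstrained apart from symmetry. *)
Definition forest_colorable (V : finType) (G : sgraph V) (k : nat) : Prop :=
  exists col : V -> V -> nat,
    [/\ forall x y, col x y = col y x,
        forall x y, G x y -> col x y < k
      & forall i, acyclic (color_class G col i)].

Lemma forest_colorable_leq (V : finType) (G : sgraph V) (k l : nat) :
  k <= l -> forest_colorable G k -> forest_colorable G l.
Proof.
move=> kl [col [cS ck cA]]; exists col; split=> // x y /ck.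
by move/leq_trans; apply.
Qed.

Lemma pair_set_inj (V : finType) (x y u v : V) :
  [set x; y] = [set u; v] -> (x = u /\ y = v) \/ (x = v /\ y = u).
Proof.
move=> E; have /set2P[xu|xv] : x \in [set u; v] by rewrite -E set21.
  have /set2P[yu|->] : y \in [set u; v] by rewrite -E set22.
    have : v \in [set x; y] by rewrite E set22.
    by rewrite xu yu => /set2P[]->; left.
  by left.
have /set2P[->|yv] : y \in [set u; v] by rewrite -E set22.
  by right.
have : u \in [set x; y] by rewrite E set21.
by rewrite xv yv => /set2P[]->; left.
Qed.

Lemma mem_edges (V : finType) (G : sgraph V) (x y : V) :
  ([set x; y] \in edges G) = G x y.
Proof.
apply/imsetP/idP => [[[u v]]|Gxy]; last by exists (x, y); rewrite ?inE.
rewrite inE /= => Guv /pair_set_inj[[-> ->]|[-> ->]] //.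
by rewrite adj_sym.
Qed.

Lemma edge_color_ex (V : finType) (col : V -> V -> nat) :
  (forall x y, col x y = col y x) ->
  exists c : {set V} -> nat, forall x y, c [set x; y] = col x y.
Proof.
move=> cS.
exists (fun e => if [pick p : V * V | e == [set p.1; p.2]] is Some p
                 then col p.1 p.2 else 0) => x y.
case: pickP => [[u v] /eqP/pair_set_inj /= [[-> ->]|[-> ->]]|] //.
by move/(_ (x, y)); rewrite eqxx.
Qed.

Lemma decomposable_of_colorable (V : finType) (G : sgraph V) (k : nat) :
  forest_colorable G k -> exists2 l, l <= k & forest_decomposable G l.
Proof.
move=> [col [cS ck cA]]; have [c cE] := edge_color_ex cS.
have edgeP e : e \in edges G -> exists x y, e = [set x; y] /\ G x y.
  by case/imsetP=> -[x y]; rewrite inE /= => Gxy ->; exists x, y.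
exists #|preim_partition c (edges G)|.
  pose F (i : 'I_k) := [set e in edges G | i == c e :> nat].
  suff /subset_leq_card : preim_partition c (edges G) \subset F @: setT.
    move/leq_trans; apply; rewrite (leq_trans (leq_imset_card _ _)) //.
    by rewrite cardsT card_ord.
  apply/subsetP => _ /imsetP[e eG ->]; have [x [y [Ee Gxy]]] := edgeP e eG.
  apply/imsetP; have cek : c e < k by rewrite Ee cE ck.
  by exists (Ordinal cek).
apply/existsP; exists (preim_partition c (edges G)); rewrite eqxx andbT.
rewrite /forest_partition preim_partitionP /=.
apply/forall_inP => _ /imsetP[e eG ->]; apply/is_forestP.
apply: (acyclic_sub _ (cA (c e))) => x y /andP[_].
by rewrite inE mem_edges cE eq_sym.
Qed.

Lemma colorable_of_decomposable (V : finType) (G : sgraph V) (k : nat) :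
  forest_decomposable G k -> forest_colorable G k.
Proof.
case/existsP=> P /andP[/andP[PG /forall_inP PF] /eqP <-].
have [/eqP PE Pt _] := and3P PG.
exists (fun x y => index (pblock P [set x; y]) (enum P)).
split=> [x y|x y Gxy|i].
- by rewrite setUC.
- by rewrite cardE index_mem mem_enum pblock_mem // PE mem_edges.
(* An edge of the supposed cycle identifies the block that contains the whole colour class. *)
- move=> s s2 sC; have: exists2 x, x \in s & exists y, color_class G
      (fun x y => index (pblock P [set x; y]) (enum P)) i x y.
    case: s s2 sC => [|x [|y s]] // _ /andP[/= /andP[xy _] _].
    by exists x; [rewrite mem_head | exists y].
  case=> x _ [y /andP[Gxy /eqP Ei]].
  have BP : pblock P [set x; y] \in P by rewrite pblock_mem // PE mem_edges.
  move/is_forestP: (PF _ BP) s s2 sC; apply: acyclic_sub => u v.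
  case/andP=> Guv /eqP Euv; rewrite /= /edge_rel.
  have uv : u != v by apply: contraTneq Guv => ->; rewrite adj_irr.
  rewrite uv /=.
  have: [set u; v] \in pblock P [set u; v] by rewrite mem_pblock PE mem_edges.
  suff -> : pblock P [set u; v] = pblock P [set x; y] by [].
  have BQ : pblock P [set u; v] \in P by rewrite pblock_mem // PE mem_edges.
  rewrite -(nth_index set0 (s := enum P) (x := pblock P [set u; v]))
    ?mem_enum //.
  by rewrite Euv -Ei nth_index ?mem_enum.
Qed.

Lemma arb_leqP (V : finType) (G : sgraph V) (k : nat) :
  arb G <= k <-> forest_colorable G k.+1.
Proof.
rewrite /arb; case: eqP => [E0|/eqP E0].
  split=> // _; apply: (@forest_colorable_leq _ _ 0) => //.
  exists (fun _ _ => 0).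
  have G0 x y : G x y = false by rewrite -mem_edges E0 inE.
  split=> // [x y|i [|x [|y s]] // _]; first by rewrite G0.
  by rewrite /ucycle /= /color_class G0.
case: ex_minnP => l lG lmin.
split=> [lk|/decomposable_of_colorable[l' l'k /lmin]].
  apply: (@forest_colorable_leq _ _ l); last exact: colorable_of_decomposable.
  by case: l lk {lG lmin}.
by move/leq_trans=> /(_ _ l'k); case: l {lG lmin}.
Qed.

(** * Caterpillars in bipartite graphs *)

Definition bip_rel (V1 V2 : Type) (R : V1 -> V2 -> bool) : rel (V1 + V2) :=
  fun u v => match u, v with
             | inl x, inr y | inr y, inl x => R x y
             | _, _ => false
             end.

Lemma bip_rel_sym (V1 V2 : Type) (R : V1 -> V2 -> bool) :
  symmetric (bip_rel R).
Proof. by case=> x [] y. Qed.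

Lemma bip_caterpillar_acyclic (V1 V2 : finType) (R : V1 -> V2 -> bool)
    (pos : V1 -> nat) :
  injective pos ->
  (forall u u' j, R u j -> R u' j -> pos u < pos u' -> pos u' = (pos u).+1) ->
  (forall u u' j j', R u j -> R u' j -> R u j' -> R u' j' -> u != u' ->
     j = j') ->
  acyclic (bip_rel R).
Proof.
move=> posI Hs Hu.
pose top j := \max_(u | R u j) pos u.
have topP u j : R u j -> exists2 u', R u' j & top j = pos u'.
  move=> uj; have [u' u'j E] := eq_bigmax_cond pos (A := fun u => R u j)
    ltac:(by apply/card_gt0P; exists u).
  by exists u'.
have le_top u j : R u j -> pos u <= top j by move=> uj; apply: leq_bigmax_cond.
(* Each [j] is put just below its highest neighbour, the only one then above it. A [j] above its
   neighbour [u] is also adjacent to the successor of [u], and two rows share at most one column. *)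
pose ord v := match v with inl u => (pos u).*2.+1 | inr j => (top j).*2 end.
apply: (@acyclic_of_ord _ _ ord); first exact: bip_rel_sym.
case=> [u|j] [?|j1] // [?|j2] //=.
  move=> R1 R2; rewrite !ltn_double => /[dup] t1 /= _ t2.
  have [u1 R1' E1] := topP _ _ R1; have [u2 R2' E2] := topP _ _ R2.
  rewrite E1 in t1; rewrite E2 in t2.
  have E : u1 = u2 by apply: posI; rewrite (Hs u u1 j1) // (Hs u u2 j2).
  congr inr; apply: (Hu u u1) => //; first by rewrite E.
  by apply: contraTneq t1 => ->; rewrite ltnn.
move=> R1 R2; rewrite !leq_Sdouble => t1 t2; congr inl; apply: posI.
apply/eqP; rewrite eqn_leq (leq_trans (le_top _ _ R1) t2).
exact: leq_trans (le_top _ _ R2) t1.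
Qed.

(** * A walk on the cycle Z_m *)

Section Walk.

Variables m c : nat.
Hypotheses (c_gt0 : 0 < c) (m_gt0 : 0 < m).

Definition walk_period := c * (m %/ gcdn (2 * c) m).

(* Vertex of Z_m from which the s-th edge (walk s, walk s + 1) is taken. The
   steps 2 c of a fixed colour class close up after m / gcd(2 c, m) rounds, so
   the walk is then shifted by one. *)
Definition walk s := 2 * s + s %/ walk_period.

Lemma walk_period_gt0 : 0 < walk_period.
Proof.
rewrite muln_gt0 c_gt0 divn_gt0 ?gcdn_gt0 ?m_gt0 ?orbT //.
by rewrite dvdn_leq ?dvdn_gcdr.
Qed.

Lemma walk_period_ge : c <= walk_period.
Proof.
rewrite leq_pmulr //; move: walk_period_gt0.
by rewrite muln_gt0 => /andP[].
Qed.

Lemma walk_mono s t : s <= t -> walk s + 2 * (t - s) <= walk t.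
Proof.
move=> st; have := leq_div2r walk_period st; rewrite /walk; clear -st; lia.
Qed.

(** The period is at least [c], so [c] consecutive steps meet at most one unit shift. *)
Lemma walk_short s t : s <= t <= s + c -> walk t <= walk s + 2 * (t - s) + 1.
Proof.
case/andP=> st tc; rewrite /walk.
have: t %/ walk_period <= (s + walk_period) %/ walk_period.
  by rewrite leq_div2r // (leq_trans tc) // leq_add2l walk_period_ge.
rewrite divnDr // divnn walk_period_gt0; lia.
Qed.

Lemma walk_inj s t : s < c * m -> t < c * m -> s = t %[mod c] ->
  walk s = walk t %[mod m] -> s = t.
Proof.
wlog st : s t / s <= t.
  move=> W; case: (leqP s t) => [|/ltnW]; first exact: W.
  by move=> ts *; apply/esym; apply: W.
move=> _ tb /eqP; rewrite eq_sym eqn_mod_dvd // => /dvdnP[d Ed] /eqP.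
rewrite eq_sym eqn_mod_dvd; last by move: (walk_mono st); lia.
set D := walk_period; set g := gcdn (2 * c) m.
have gm : g %| m by apply: dvdn_gcdr.
have g0 : 0 < g by rewrite gcdn_gt0 m_gt0 orbT.
set p := m %/ g; have Ep : m = p * g by rewrite divnK.
have DE : D = c * p by [].
have D0 : 0 < D := walk_period_gt0.
have le_st := leq_div2r D st.
have -> : walk t - walk s = (2 * c) * d + (t %/ D - s %/ D).
  have -> : 2 * c * d = 2 * (t - s) by rewrite Ed; lia.
  by rewrite /walk -/D; move: (s %/ D) (t %/ D) le_st st => a b; lia.
move=> mdiv.
(* Since [g] divides both [m] and [2 * c], it divides the difference of the two shifts; these are
   below [g] because [c * m = D * g]. *)
have Eq : s %/ D = t %/ D.
  have tg : t %/ D < g by rewrite ltn_divLR // DE; move: tb; rewrite Ep; nia.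
  have: g %| t %/ D - s %/ D.
    rewrite -(dvdn_addr (m := (2 * c) * d)); first exact: dvdn_trans mdiv.
    by rewrite dvdn_mulr // dvdn_gcdl.
  move: (s %/ D) (t %/ D) le_st tg => a b ab bg.
  by case: (posnP (b - a)) => [|/dvdn_leq h /h]; clear -ab bg; lia.
move: mdiv; rewrite Eq subnn addn0 => mdiv.
(* Within one period, [m] divides [2 * c * d], so [d] is a multiple of the order [p] of [2 * c] in
   Z_m. Then [D] divides [t - s], which is less than [D]. *)
have pd : p %| d.
  have: m %| g * d by rewrite muln_gcdl dvdn_gcd mdiv dvdn_mulr.
  by rewrite {1}Ep mulnC dvdn_pmul2l.
have: D %| t - s by rewrite Ed DE mulnC dvdn_pmul2r.
have := divn_eq t D; have := divn_eq s D; rewrite Eq.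
have := ltn_pmod t D0; have := ltn_pmod s D0.
move: (t %/ D * D) (s %% D) (t %% D) st => x y z st yD zD Es Et.
by case: (posnP (t - s)) => [|/dvdn_leq h /h]; clear -st yD zD Es Et; lia.
Qed.

End Walk.

(** * Complete bipartite graphs with more rows than colours *)

Lemma leftover_injection (U C : finType) (R : {set U}) (K : {set C}) (c0 : C) :
  #|R| <= #|K| ->
  exists2 g : U -> C, {in R &, injective g} & forall u, u \in R -> g u \in K.
Proof.
move=> RK; pose g u := nth c0 (enum K) (index u (enum R)).
have gi u : u \in R -> index u (enum R) < size (enum K).
  by move=> uR; rewrite -cardE (leq_trans _ RK) // cardE index_mem mem_enum.
exists g => [u v uR vR /eqP|u uR]; last by rewrite -mem_enum mem_nth ?gi.
rewrite nth_uniq ?gi ?enum_uniq // => /eqP E.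
by rewrite -(nth_index u (s := enum R) (x := u)) ?mem_enum // E
  nth_index ?mem_enum.
Qed.

Lemma eqn_mod_window (m w x y : nat) :
  w <= x < w + m -> w <= y < w + m -> x = y %[mod m] -> x = y.
Proof.
wlog xy : x y / x <= y.
  move=> W; case: (leqP x y) => [|/ltnW yx wx wy E]; first exact: W.
  by apply/esym; apply: W.
move=> wx wy /eqP; rewrite eq_sym eqn_mod_dvd //.
by case: (posnP (y - x)) => [|/dvdn_leq h /h]; clear -xy wx wy; lia.
Qed.

Section CompleteBipartite.

Variables a c : nat.
Hypothesis ac : a < c.

Local Notation m := (a + c).

Let c_gt0 : 0 < c. Proof. exact: leq_ltn_trans ac. Qed.

Let m_gt0 : 0 < m. Proof. by rewrite addn_gt0 c_gt0 orbT. Qed.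

Local Notation walk := (walk m c).

Definition residue (x : nat) : 'I_m := Ordinal (ltn_pmod x m_gt0).

(* Colours 2 a of the m entries in pairs, leaving m - 2 a entries and c - a
   colours. *)
Lemma column_coloring (s0 : nat) :
  exists g : 'I_m -> 'I_c, forall u v, g u = g v -> u != v ->
    exists2 t, t < a & (s0 + t) %% c = g u /\
      let x := walk (s0 + t) in
      (u = residue x /\ v = residue x.+1) \/
      (v = residue x /\ u = residue x.+1).
Proof.
pose pr (p : 'I_a * bool) := residue (walk (s0 + p.1) + p.2).
pose kap (t : 'I_a) : 'I_c := Ordinal (ltn_pmod (s0 + t) c_gt0).
have prI : injective pr.
  (* The [a] edges end by [walk s0 + 2 * a], and [2 * a < m] because [a < c]; they do not wrap
     around the cycle. *)
  have bound t (b : bool) : t < a -> walk s0 <= walk (s0 + t) + b < walk s0 + m.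
    move=> ta; have := walk_mono m c (leq_addr t s0).
    have := @walk_short _ _ c_gt0 m_gt0 s0 (s0 + t).
    rewrite leq_addr leq_add2l (ltnW (ltn_trans ta ac)) addKn => /(_ isT).
    by move: (walk s0) (walk (s0 + t)); clear -ta ac; case: b; lia.
  case=> [t b] [t' b'] /(congr1 val) /= E.
  have {}E := eqn_mod_window (bound t b (ltn_ord t))
    (bound t' b' (ltn_ord t')) E.
  (* Distinct steps differ by at least 2, while [b] and [b'] differ by at most 1. *)
  have tt' : t = t' :> nat.
    case: (ltngtP t t') => // lt; exfalso; move: E.
      have := walk_mono m c (s := s0 + t) (t := s0 + t').
      rewrite leq_add2l (ltnW lt) => /(_ isT).
      by clear -lt; case: b b' => -[]; lia.
    have := walk_mono m c (s := s0 + t') (t := s0 + t).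
    rewrite leq_add2l (ltnW lt) => /(_ isT).
    by clear -lt; case: b b' => -[]; lia.
  move: E; rewrite tt' => /addnI bb'; congr pair; first exact: val_inj.
  by case: b b' bb' => -[].
have kapI : injective kap.
  move=> t t' /(congr1 val) /= /eqP.
  rewrite eqn_modDl !modn_small ?(ltn_trans _ ac) //.
  by move/eqP/val_inj.
have RK : #|~: (pr @: setT)| <= #|~: (kap @: setT)|.
  rewrite [leqLHS]cardsCs [leqRHS]cardsCs !setCK !card_imset //.
  rewrite !cardsT card_prod card_bool !card_ord.
  by clear -ac; lia.
have [g gI gK] := leftover_injection (Ordinal c_gt0) RK.
pose h u := if [pick p | pr p == u] is Some p then kap p.1 else g u.
have hP u : (exists2 p, u = pr p & h u = kap p.1) \/
            (u \in ~: (pr @: setT) /\ h u = g u).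
  rewrite /h; case: pickP => [p /eqP <-|no]; [by left; exists p | right].
  split=> //; rewrite inE; apply/imsetP => -[p _ E].
  by move: (no p); rewrite E eqxx.
have not_kap v t : v \in ~: (pr @: setT) -> g v <> kap t.
  by move=> /gK; rewrite inE => + E; rewrite E imset_f ?inE.
exists h => u v + uv.
have [[[t b] Eu ->]|[uR ->]] := hP u; have [[[t' b'] Ev ->]|[vR ->]] := hP v.
- move=> /= /kapI E; rewrite -{}E {t'} in Ev *.
  exists t => //; split=> //=.
  move: Eu Ev uv; rewrite /pr /=; case: b b' => -[]; rewrite /= ?addn0 ?addn1.
  + by move=> -> ->; rewrite eqxx.
  + by move=> -> ->; right.
  + by move=> -> ->; left.
  + by move=> -> ->; rewrite eqxx.
- by move/esym/not_kap => /(_ vR).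
- by move/not_kap => /(_ uR).
- by move/gI => E; rewrite E // eqxx in uv.
Qed.

(** Column [j] receives the pairs numbered from [j * a] up to, but excluding, [j.+1 * a]. All
    numbers stay below [c * m.-1], so each colour class uses at most [m.-1] edges of the cycle and
    leaves one to cut. *)
Lemma bip_coloring_excess (n : nat) : n * a <= c * m.-1 ->
  exists col : 'I_m -> 'I_n -> 'I_c,
    forall i, acyclic (bip_rel (fun u j => col u j == i)).
Proof.
move=> na.
have [f fP] := fin_all_exists (fun j : 'I_n => column_coloring (j * a)).
exists (fun u j => f j u) => i.
have m1 : m.-1.+1 = m by rewrite prednK ?m_gt0.
(* The edge of the cycle Z_m that colour i does not use. *)
pose s1 := i + c * m.-1; pose shift x := x + (m.-1 * walk s1 + m.-1).
(* Modulo [m], [shift x] is [x - walk s1 - 1]: the Hamiltonian path starts at [walk s1 + 1] and ends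
   at [walk s1]. *)
pose pos (u : 'I_m) := shift u %% m.
have posE x : pos (residue x) = shift x %% m by rewrite /pos /shift /= modnDml.
have posI : injective pos.
  move=> u v /eqP; rewrite /pos /shift eqn_modDr !modn_small // => /eqP.
  exact: val_inj.
have used (j : 'I_n) t : t < a -> j * a + t < c * m.-1.
  move=> ta; apply: leq_trans na; apply: (@leq_trans (j.+1 * a)).
    by rewrite mulSn addnC ltn_add2r.
  by rewrite leq_mul2r ltn_ord orbT.
(* The weaker bound on [t] admits [s1]. *)
have walkI s t : s < c * m.-1 -> t < c * m -> s %% c = i -> t %% c = i ->
    residue (walk s) = residue (walk t) -> s = t.
  move=> sb tb si ti /(congr1 val) /= E.
  apply: (walk_inj c_gt0 m_gt0) => //; last by rewrite si ti.
  by apply: leq_trans sb _; rewrite leq_mul2l leq_pred orbT.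
have posS s : s < c * m.-1 -> s %% c = i ->
    pos (residue (walk s).+1) = (pos (residue (walk s))).+1.
  move=> sb si; rewrite !posE /shift addSn -addn1 -modnDml addn1.
  rewrite modn_small // -[X in _ < X]m1 ltnS ltn_neqAle andbC -ltnS m1.
  (* The position could only wrap around at the end of the path, which would force [s = s1]. *)
  rewrite ltn_pmod ?m_gt0 //=; apply/negP => /eqP E.
  have Es1 : shift (walk s1) %% m = m.-1.
    by rewrite /shift addnA -mulSn m1 mulnC modnMDl modn_small // m1.
  have Es : s = s1.
    apply: walkI => //.
    - by rewrite /s1 -{2}m1 mulnS ltn_add2r.
    - by rewrite /s1 addnC mulnC modnMDl modn_small.
    - by apply: posI; rewrite !posE E.
  by move: sb; rewrite Es /s1 ltnNge leq_addl.
apply: (bip_caterpillar_acyclic posI) => [u v j /eqP Eu /eqP Ev uv|].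
  have neq : u != v by apply: contraTneq uv => ->; rewrite ltnn.
  have [|t ta [ti]] := fP j u v _ neq; first by rewrite Eu Ev.
  have := posS _ (used j t ta); rewrite ti Eu => /(_ erefl) E.
  case=> -[Eu' Ev'] //; rewrite ?Eu' ?Ev' //.
  by move: uv; rewrite Eu' Ev' E ltnNge leqnSn.
move=> u v j j' /eqP uj /eqP vj /eqP uj' /eqP vj' uv.
have [|t ta [ti tP]] := fP j u v _ uv; first by rewrite uj vj.
have [|t' ta' [ti' tP']] := fP j' u v _ uv; first by rewrite uj' vj'.
rewrite uj in ti; rewrite uj' in ti'.
have pt := posS _ (used j t ta) ti.
have pt' := posS _ (used j' t' ta') ti'.
(* Equal starting vertices give equal pair numbers, and division by [a] recovers the column. If the
   two edges ran in opposite directions, [pos u] and [pos v] would each be the successor of the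
   other. *)
suff E : residue (walk (j * a + t)) = residue (walk (j' * a + t')).
  have a0 : 0 < a by apply: leq_ltn_trans ta.
  have Es : j * a + t = j' * a + t'.
    apply: walkI => //; first exact: used.
    by apply: leq_trans (used j' t' ta') _; rewrite leq_mul2l leq_pred orbT.
  apply: val_inj; move/(congr1 (divn^~ a)): Es.
  by rewrite /= !divnMDl // !divn_small // !addn0.
case: tP tP' => -[Eu Ev] [] [Eu' Ev'].
- by rewrite -Eu.
- move: pt pt'; rewrite -Eu -Ev -Eu' -Ev' => ->.
  by clear; lia.
- move: pt pt'; rewrite -Eu -Ev -Eu' -Ev' => ->.
  by clear; lia.
- by rewrite -Eu.
Qed.

End CompleteBipartite.

(** * Forest colourings of complete bipartite graphs *)

Definition bip_colorable (V1 V2 : finType) (c : nat) : Prop :=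
  exists2 col : V1 -> V2 -> nat, forall x y, col x y < c &
    forall i, acyclic (bip_rel (fun x y => col x y == i)).

Lemma bip_colorable_sym (V1 V2 : finType) (c : nat) :
  bip_colorable V1 V2 c -> bip_colorable V2 V1 c.
Proof.
case=> col cc cA; exists (fun y x => col x y) => // i.
pose swap (v : V2 + V1) := match v with inl y => inr y | inr x => inl x end.
by apply: (acyclic_inj (f := swap) _ _ (cA i)) => [[]u[]v // [->]|[]u[]v].
Qed.

Lemma bip_colorable_ord (V1 V2 : finType) (c : nat) :
  bip_colorable 'I_#|V1| 'I_#|V2| c -> bip_colorable V1 V2 c.
Proof.
case=> col cc cA.
exists (fun x y => col (enum_rank x) (enum_rank y)) => // i.
pose rank (v : V1 + V2) :=
  match v with inl x => inl (enum_rank x) | inr y => inr (enum_rank y) end.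
apply: (acyclic_inj (f := rank) _ _ (cA i)) => [|[]u[]v] //.
by move=> []u[]v // [/enum_rank_inj ->].
Qed.

Lemma bip_colorable_excess (m n c : nat) :
  0 < m -> m <= n -> m * n <= c * (m + n).-1 -> bip_colorable 'I_m 'I_n c.
Proof.
move=> m0 mn mnc; have [mc|cm] := leqP m c.
  exists (fun (u : 'I_m) _ => val u) => [u _|i].
    exact: leq_trans (ltn_ord u) mc.
  apply: (bip_caterpillar_acyclic (@ord_inj m)) => [u v _ /eqP -> /eqP ->|].
    by rewrite ltnn.
  by move=> u v j j' /eqP ui /eqP vi _ _; rewrite -val_eqE /= ui vi eqxx.
have c0 : 0 < c by clear -m0 mn mnc; case: c mnc => //; nia.
have Em : m = (m - c) + c by rewrite subnK // ltnW.
(* The second bound is the hypothesis minus [c * n]. It implies the first: if [m - c >= c], then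
   [n * (m - c) >= m * c], as [n >= m]. *)
have [ac na] : m - c < c /\ n * (m - c) <= c * m.-1.
  have [k Ek] : exists k, m = k + c by exists (m - c).
  by rewrite Ek addnK; rewrite Ek in mnc mn cm; clear -c0 mnc mn cm; split; nia.
rewrite Em; have [|col colA] := @bip_coloring_excess (m - c) c ac n.
  by rewrite -Em.
exists (fun u j => col u j) => [u j|i]; first exact: ltn_ord.
(* A colour [i >= c] has an empty class, contained in that of colour 0. *)
case: (ltnP i c) => ic; first exact: (colA (Ordinal ic)).
apply: (acyclic_sub _ (colA (Ordinal c0))) => -[]u[]v //= /eqP E; move: ic.
  by rewrite -E leqNgt ltn_ord.
by rewrite -E leqNgt ltn_ord.
Qed.

Lemma bip_colorable_leq (V1 V2 : finType) (c : nat) :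
  0 < #|V1| -> 0 < #|V2| -> #|V1| * #|V2| <= c * (#|V1| + #|V2|).-1 ->
  bip_colorable V1 V2 c.
Proof.
move=> V1_gt0 V2_gt0 le_c; apply: bip_colorable_ord.
have [le12|/ltnW le21] := leqP #|V1| #|V2|; first exact: bip_colorable_excess.
by apply/bip_colorable_sym/bip_colorable_excess => //; rewrite mulnC addnC.
Qed.

(** * Forest colourings of the join *)

Lemma join_colorable (V1 V2 : finType) (G1 : sgraph V1) (G2 : sgraph V2)
    (k c : nat) :
  forest_colorable G1 k -> forest_colorable G2 k -> bip_colorable V1 V2 c ->
  forest_colorable (join G1 G2) (k + c).
Proof.
move=> [col1 [S1 k1 A1]] [col2 [S2 k2 A2]] [col ck cA].
pose jcol (u v : V1 + V2) := match u, v with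
  | inl x, inl y => col1 x y
  | inr x, inr y => col2 x y
  | inl x, inr y | inr y, inl x => k + col x y
  end.
have jS u v : jcol u v = jcol v u by case: u v => u [] v /=.
exists jcol; split=> // [[]u[]v //= G|i].
- by rewrite ltn_addr // k1.
- by rewrite ltn_add2l.
- by rewrite ltn_add2l.
- by rewrite ltn_addr // k2.
have [ki|ik] := leqP k i.
  apply: (acyclic_sub _ (cA (i - k))) => -[]u[]v /andP[/= Guv /eqP Ei] /=.
  - by move: ki; rewrite -Ei leqNgt k1.
  - by rewrite -Ei addKn.
  - by rewrite -Ei addKn.
  - by move: ki; rewrite -Ei leqNgt k2.
have [|x|ord1 _ O1] := acyclic_ord (e := color_class G1 col1 i) _ _ (A1 i).
- by move=> x y; rewrite /color_class adj_sym S1.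
- by rewrite /color_class adj_irr.
have [|x|ord2 _ O2] := acyclic_ord (e := color_class G2 col2 i) _ _ (A2 i).
- by move=> x y; rewrite /color_class adj_sym S2.
- by rewrite /color_class adj_irr.
(* The two orders may interleave arbitrarily: no edge of a colour below [k] joins the two sides. *)
pose ord v := match v with inl x => ord1 x | inr y => ord2 y end.
apply: (@acyclic_of_ord _ _ ord) => [u v|].
  by rewrite /color_class adj_sym jS.
have cross x y : (k + col x y == i) = false.
  by apply: contraTF ik => /eqP <-; rewrite -leqNgt leq_addr.
move=> []v[]w1[]w2; rewrite /color_class /= ?cross //.
- by move=> e1 e2 o1 o2; congr inl; apply: (O1 v).
- by move=> e1 e2 o1 o2; congr inr; apply: (O2 v).
Qed.

Lemma join_colorable_sub (V1 V2 : finType) (G1 : sgraph V1) (G2 : sgraph V2)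
    (k : nat) :
  forest_colorable (join G1 G2) k ->
  forest_colorable G1 k /\ forest_colorable G2 k.
Proof.
move=> [col [cS ck cA]]; split.
  exists (fun x y => col (inl x) (inl y)); split=> // [x y G|i].
    exact: ck.
  by apply: (acyclic_inj (f := inl) _ _ (cA i)) => // x y [].
exists (fun x y => col (inr x) (inr y)); split=> // [x y G|i].
  exact: ck.
by apply: (acyclic_inj (f := inr) _ _ (cA i)) => // x y [].
Qed.

Lemma join_colorable_count (V1 V2 : finType) (G1 : sgraph V1) (G2 : sgraph V2)
    (k : nat) :
  0 < #|V1| -> forest_colorable (join G1 G2) k ->
  #|V1| * #|V2| <= k * (#|V1| + #|V2|).-1.
Proof.
move=> V1_gt0 [col [cS ck cA]].
(* Cross edges are oriented from [V1] to [V2], so that [acyclic_card] bounds each class by the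
   number of vertices minus one. *)
pose E i : {set (V1 + V2) * (V1 + V2)} :=
  [set p | if p is (inl x, inr y) then col p.1 p.2 == i :> nat else false].
have Ei i : #|E i| <= (#|V1| + #|V2|).-1.
  have W0 : 0 < #|{: V1 + V2}| by rewrite card_sum addn_gt0 V1_gt0.
  rewrite -ltnS prednK -card_sum //.
  apply: (acyclic_card _ _ (cA i) W0) => [u v|u|[[]x []y]]; rewrite ?inE //.
  - by rewrite /color_class adj_sym cS.
  - by rewrite /color_class adj_irr.
pose cross (p : V1 * V2) : (V1 + V2) * (V1 + V2) := (inl p.1, inr p.2).
have crossI : injective cross by move=> [x y] [x' y'] [-> ->].
have -> : #|V1| * #|V2| = #|cross @: setT|.
  by rewrite card_imset // cardsT card_prod.
have -> : cross @: setT = \bigcup_(i < k) E i.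
  apply/setP=> p; apply/imsetP/bigcupP => [[[x y] _ ->]|].
    have xyk : col (inl x) (inr y) < k by apply: ck.
    by exists (Ordinal xyk) => //; rewrite inE /=.
  case: p => [[]x []y] [i _]; rewrite inE //.
  by exists (x, y); rewrite ?inE.
apply: (@leq_trans (\sum_(i < k) #|E i|)).
  elim/big_rec2: _ => [|i x A _ Ax]; first by rewrite cards0.
  by rewrite (leq_trans (leq_card_setU _ _)) // leq_add2l.
rewrite -[X in (X * _)%N]card_ord -sum_nat_const.
by apply: leq_sum => i _; apply: Ei.
Qed.

Local Open Scope ring_scope.

Theorem theorem23 (V1 V2 : finType) (G1 : sgraph V1) (G2 : sgraph V2)
    (n1 n2 : nat) (hV1 : #|V1| = n1) (hV2 : #|V2| = n2)
    (hn1 : (1 <= n1)%N) (hn2 : (1 <= n2)%N) :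
  let B : int :=
    Num.ceil (n1%:R * n2%:R / (n1%:R + n2%:R - 1) : rat) - 1 in
  Num.max (Num.max (arb G1)%:Z (arb G2)%:Z) B <= (arb (join G1 G2))%:Z
  /\ (arb (join G1 G2))%:Z <= (arb G1)%:Z + (arb G2)%:Z + B + 1.
Proof.
set q : rat := _ / _ => B.
have V1_gt0 : (0 < #|V1|)%N by rewrite hV1.
have V2_gt0 : (0 < #|V2|)%N by rewrite hV2.
(* Clearing the positive denominator turns bounds on the ceiling into the inequality between
   naturals used above. *)
have q_le (k : nat) : (q <= k%:R) = (n1 * n2 <= k * (n1 + n2).-1)%N.
  have -> : q = (n1 * n2)%:R / ((n1 + n2).-1)%:R.
    by rewrite /q natrM -natrD -subn1 natrB // addn_gt0 hn1.
  rewrite ler_pdivrMr -?natrM ?ler_nat // ltr0n.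
  by move: hn1 hn2; clear; lia.
split.
  have J := (arb_leqP _ _).1 (leqnn (arb (join G1 G2))).
  have [J1 J2] := join_colorable_sub J.
  rewrite !ge_max !lez_nat (arb_leqP _ _).2 //= (arb_leqP _ _).2 //=.
  rewrite lerBlDr -PoszD addn1 ceil_le_int q_le -hV1 -hV2.
  by apply: join_colorable_count V1_gt0 J.
have [c Ec] : exists c : nat, Num.ceil q = c%:Z.
  have : 0 <= Num.ceil q.
    rewrite ceil_ge0 (lt_le_trans (ltrN10 _)) // divr_ge0 ?mulr_ge0 //.
    by rewrite subr_ge0 -natrD ler1n addn_gt0 hn1.
  by case: (Num.ceil q) => // c _; exists c.
have le_c : (#|V1| * #|V2| <= c * (#|V1| + #|V2|).-1)%N.
  by rewrite hV1 hV2 -q_le (pmulrn _ c) -Ec ceil_ge.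
(* Both graphs are coloured from one palette of [arb G1 + arb G2 + 1] colours; the cross edges take
   [c = B + 1] further ones, and the reduced arboricity is one less than the total. *)
have C1 := (arb_leqP G1 _).1 (leq_addr (arb G2) (arb G1)).
have C2 := (arb_leqP G2 _).1 (leq_addl (arb G1) (arb G2)).
have := join_colorable C1 C2 (bip_colorable_leq V1_gt0 V2_gt0 le_c).
by rewrite /B Ec addSn => /arb_leqP; clear; lia.
Qed.
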